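(* Let $\Gamma$ be a group and $X$ a set. For each $g\in\Gamma$ let $\phi(g):X\to X$ be a bijection, with $\phi(1)$ the identity. For $p,q\in\Gamma$ define $B(p,q)=\{x\in X : \phi(p)(\phi(q)(x))\neq\phi(pq)(x)\}$. The following conditions are equivalent: (1) $(\Gamma,X,\mu,\phi)$ is an essentially free amenable almost-action for some finitely additive probability measure $\mu$ on $X$. (2) $\phi$ is non-paradoxical in the following sense: $X$ cannot be written as a union of (finitely many) subsets $X=A_1\cup\dots\cup A_l\cup B_1\cup\dots\cup B_m\cup C_1\cup\dots\cup C_n$ such that (a) for some group elements $g_1,h_1,\dots,g_l,h_l\in\Gamma$ the $2l$ subsets $\phi(g_1)(A_1),\phi(h_1)(A_1),\dots,\phi(g_l)(A_l),\phi(h_l)(A_l)$ are pairwise disjoint; (b) for each $B_i$ there are elements $p_i,q_i\in\Gamma$ with $B_i=B(p_i,q_i)$; (c) for each $C_i$ there is an element $1\ne r_i\in\Gamma$ with $C_i=\mathrm{Fix}(\phi(r_i)|X)$. (3) For any finite subset $K\subseteq\Gamma$ and any $\epsilon>0$ there exists a non-empty finite subset $F\subseteq X$ such that (a) $\frac{|\phi(g)(F)\,\triangle\, F|}{|F|}<\epsilon$ for any $g\in K$; (b) $\frac{|B(p,q)\cap F|}{|F|}<\epsilon$ for any $p,q\in K$; (c) $\frac{|\mathrm{Fix}(\phi(g)|X)\cap F|}{|F|}<\epsilon$ for any $1\ne g\in K$.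
   Context: $\mathrm{Fix}(\psi|X)$ denotes the fixed point set of a bijection $\psi:X\to X$. Let $\mu$ be a finitely additive probability measure defined on all subsets of $X$, and for each $g\in\Gamma$ let $\phi(g):X\to X$ be a bijection. $(\Gamma,X,\mu,\phi)$ is an amenable almost-action if: (i) $\phi(1)$ is the identity transformation of $X$; (ii) $\mu(\phi(g)(L))=\mu(L)$ for all $g\in\Gamma$, $L\subseteq X$; (iii) for any $g,h\in\Gamma$ there exists a subset $A_{g,h}\subseteq X$ with $\mu(A_{g,h})=1$ such that $\phi(gh)(x)=\phi(g)(\phi(h)(x))$ for all $x\in A_{g,h}$. It is essentially free if $\mu(\mathrm{Fix}(\phi(g)|X))=0$ for all $1\neq g\in\Gamma$. In condition (2), $l,m,n\ge0$ are allowed; $\triangle$ denotes symmetric difference. *)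

(* Defs.v *)
From mathcomp Require Import all_boot all_order all_algebra finmap.
From mathcomp Require Import mathcomp_extra boolp classical_sets functions.
From mathcomp Require Import cardinality reals.

Set Implicit Arguments.
Unset Strict Implicit.
Unset Printing Implicit Defensive.

Import Order.TTheory GRing.Theory Num.Theory.
Local Open Scope classical_set_scope.
Local Open Scope ring_scope.

Definition Fix (X : Type) (f : X -> X) : set X := [set x | f x = x].

Definition defect (G : groupType) (X : Type) (phi : G -> X -> X) (p q : G) :
  set X := [set x | phi p (phi q x) <> phi (p * q)%g x].

(* Finitely additive probability measures on the full powerset; the value at
   [set0] is forced to be 0 by additivity. *)
Record fin_additive_probability (R : realType) (X : Type) (mu : set X -> R) :
  Prop := FinAdditiveProbability {
  fap_ge0 : forall A : set X, 0 <= mu A ;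
  fap_setU : forall A B : set X,
    A `&` B = set0 -> mu (A `|` B) = mu A + mu B ;
  fap_setT : mu setT = 1 }.

Record amenable_almost_action (R : realType) (G : groupType) (X : Type)
    (mu : set X -> R) (phi : G -> X -> X) : Prop := AmenableAlmostAction {
  aaa_prob : fin_additive_probability mu ;
  aaa_bij : forall g : G, bijective (phi g) ;
  aaa_one : forall x : X, phi 1%g x = x ;
  aaa_inv : forall (g : G) (L : set X), mu (phi g @` L) = mu L ;
  aaa_mul : forall g h : G, exists A : set X,
    mu A = 1 /\ forall x, A x -> phi (g * h)%g x = phi g (phi h x) }.

Definition essentially_free (R : realType) (G : groupType) (X : Type)
    (mu : set X -> R) (phi : G -> X -> X) : Prop :=
  forall g : G, g <> 1%g -> mu (Fix (phi g)) = 0.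

(* Disjointness is required of the family indexed by ['I_l * bool], the boolean
   choosing between [g i] and [h i]: two members with distinct indices must be
   disjoint even if they coincide as sets. *)
Definition paradoxical (G : groupType) (X : Type) (phi : G -> X -> X) : Prop :=
  exists (l m n : nat) (A : 'I_l -> set X) (B : 'I_m -> set X)
         (C : 'I_n -> set X),
  [/\ [set: X] = (\bigcup_i A i) `|` (\bigcup_i B i) `|` (\bigcup_i C i),
      exists g h : 'I_l -> G,
        trivIset [set: 'I_l * bool]
          (fun k => phi (if k.2 then h k.1 else g k.1) @` A k.1),
      forall i, exists p q : G, B i = defect phi p q
    & forall i, exists r : G, r <> 1%g /\ C i = Fix (phi r)].

(* Number of elements of a finite set; [fset_set] sends infinite sets to the
   empty one, so [card A] is meaningful only when [A] is finite. *)
Definition card (R : realType) (X : choiceType) (A : set X) : R :=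
  #|` fset_set A|%:R.
Arguments card R {X} A.

Definition folner_condition (R : realType) (G : groupType) (X : choiceType)
    (phi : G -> X -> X) : Prop :=
  forall (K : set G) (eps : R), finite_set K -> 0 < eps ->
  exists F : set X,
  [/\ finite_set F /\ F !=set0,
      forall g, K g -> card R ((phi g @` F) `+` F) / card R F < eps,
      forall p q, K p -> K q ->
        card R (defect phi p q `&` F) / card R F < eps
    & forall g, g <> 1%g -> K g ->
        card R (Fix (phi g) `&` F) / card R F < eps].

(* Main.v *)
From mathcomp Require Import all_boot all_order all_algebra finmap lra.
From mathcomp Require Import boolp classical_sets functions cardinality reals.
From mathcomp Require Import filter topology normedtype.
Require Import Defs.

(** An invariant measure gives the sets [A_i] of a paradoxical cover total mass
    at most 1/2 and kills the other pieces.  If the Folner condition fails for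
    [(K, eps)], finite sets avoiding finitely many defect and fixed-point sets
    grow by a factor at least [1 + eps / 2] under [K] at each step, hence double
    under some finite [T]; the infinite Hall theorem then selects two injections
    with disjoint images that act piecewise by elements of [T], which is a
    paradox.  Finally, ultralimits of the relative densities [|A `&` F| / |F|]
    along Folner sets [F] give the measure. *)

Set Implicit Arguments.
Unset Strict Implicit.
Unset Printing Implicit Defensive.

Import Order.TTheory GRing.Theory Num.Theory.
Import numFieldNormedType.Exports.
Local Open Scope classical_set_scope.
Local Open Scope ring_scope.

(** * Hall's theorem for an infinite family of finite sets *)

Section Hall.
Local Open Scope fset_scope.
Local Open Scope nat_scope.
Variables V Y : choiceType.
Implicit Types (N M : V -> {fset Y}) (S : {fset V}).

Definition hall_condition N : Prop :=
  forall S, #|` S| <= #|` \bigcup_(v <- S) N v|.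

(** The lower bound is the pointwise intersection of the chain. Since each [M v] is finite, this
    intersection is attained at [v] by a member of least cardinality there; a single member attains
    it on any given finite set of vertices, and Hall's condition inspects only one finite set at a
    time. For an empty chain [N] itself serves. *)
Lemma hall_chain N (A : set (V -> {fset Y})) :
    hall_condition N -> (forall M, A M -> hall_condition M) ->
    (forall M M', A M -> A M' ->
       (forall v, M v `<=` M' v) \/ (forall v, M' v `<=` M v)) ->
  exists M, hall_condition M /\
    ((forall M', A M' -> forall v, M v `<=` M' v) /\
     (A = set0 \/ forall v, exists2 M', A M' & M v = M' v)).
Proof.
move=> hN hA totA; have [->|/eqP/set0P[M0 AM0]] := pselect (A = set0).
  by exists N; split=> //; split; [move=> M' []|left].
have min v : exists M, A M /\ forall M', A M' -> M v `<=` M' v.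
  have ex : exists n, `[< exists2 M, A M & #|` M v| = n >].
    by exists #|` M0 v|; apply/asboolP; exists M0.
  case: (ex_minnP ex) => n /asboolP[M AM <-] minM; exists M; split=> // M' AM'.
  have [/(_ v)//|/(_ v) sM'M] := totA _ _ AM AM'.
  have leM : #|` M v| <= #|` M' v| by apply: minM; apply/asboolP; exists M'.
  by have /eqP-> : M' v == M v by rewrite eqEfcard sM'M.
have [m mP] := choice min.
(* Of two comparable members, the smaller one keeps every minimum that the other attains. *)
have finite_min (s : seq V) : exists2 M, A M & forall v, v \in s -> M v = m v v.
  elim: s => [|v s [M AM Ms]]; first by exists M0.
  have [Amv mvmin] := mP v.
  have [sMm|smM] := totA _ _ AM Amv.
    exists M => // u /[!inE] /orP[/eqP->|/Ms//].
    by apply/eqP; rewrite eqEfsubset sMm mvmin.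
  exists (m v) => // u /[!inE] /orP[/eqP->//|us].
  apply/eqP; rewrite eqEfsubset -{1}(Ms _ us) smM /=.
  by have [_ ->] := mP u.
exists (fun v => m v v); split; last split.
- move=> S; have [M AM MS] := finite_min S.
  rewrite (eq_big_seq M) => [|v /MS //]; exact: hA.
- by move=> M' AM' v; have [_ ->] := mP v.
- by right=> v; exists (m v) => //; have [] := mP v.
Qed.

(** Zorn's lemma on the Hall subsystems of [N], ordered by reverse inclusion so that maximal means
    minimal; [hall_chain] bounds the chains. *)
Lemma hall_minimal N : hall_condition N ->
  exists M, [/\ hall_condition M, forall v, M v `<=` N v
   & forall M', hall_condition M' -> (forall v, M' v `<=` M v) -> M' = M].
Proof.
move=> hN; pose T := {M | hall_condition M /\ forall v, M v `<=` N v}.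
pose R (M M' : T) := `[< forall v, sval M' v `<=` sval M v >].
have [||||[M [hM sMN]] maxM] := @Zorn T R.
- by move=> M; apply/asboolP.
- move=> M M' M'' /asboolP sM /asboolP sM'; apply/asboolP => v.
  exact: fsubset_trans (sM' v) (sM v).
- move=> [M pM] [M' pM'] /asboolP /= sM /asboolP /= sM'.
  apply: eq_exist => /=; apply/funext => v; apply/eqP.
  by rewrite eqEfsubset sM sM'.
- move=> A totA; pose A' := ((fun M : T => sval M) @` A)%classic.
  have [||M [hM [lbM AM]]] := @hall_chain N A' hN.
  + by move=> _ [[M [hM sM]] _ <-].
  + move=> _ _ [M AM <-] [M' AM' <-].
    by have [/asboolP|/asboolP] := totA _ _ AM AM'; [right|left].
  case: AM => [A0|AM].
    exists (exist _ N (conj hN (fun v => fsubset_refl _))) => M' AM'.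
    by have : A' (sval M') by [exists M'] ; rewrite A0.
  have sMN v : M v `<=` N v by have [_ [[M' [? sM']] _ <-] ->] := AM v.
  exists (exist _ M (conj hM sMN)) => M' AM'; apply/asboolP => v /=.
  by apply: lbM; exists M'.
- exists M; split=> // M' hM' sM'.
  have sM'N v : M' v `<=` N v by apply: fsubset_trans (sMN v).
  pose t : T := exist _ M' (conj hM' sM'N).
  by have /(congr1 sval) := maxM t (asboolT sM').
Qed.

(* Rado's argument: if a minimal system had two elements y1, y2 in M v,
   deleting either would break Hall's condition on some S1, S2; the
   neighbourhoods of S1 and S2 with v added are then too small by
   submodularity of cardinality. *)
Lemma hall_minimal_le1 M : hall_condition M ->
    (forall M', hall_condition M' -> (forall v, M' v `<=` M v) -> M' = M) ->
  forall v y1 y2, y1 \in M v -> y2 \in M v -> y1 = y2.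
Proof.
move=> hM minM v.
have deficient y : y \in M v -> exists2 S : {fset V}, v \notin S &
    #|` (\bigcup_(u <- S) M u) `|` (M v `\ y)| <= #|` S|.
  move=> yM; pose M' u := if u == v then M v `\ y else M u.
  have : ~ hall_condition M'.
    move=> hM'; have /(congr1 (fun f => y \in f v)) : M' = M.
      apply: minM => // u; rewrite /M'; case: eqP => [->|//].
      exact: fsubD1set.
    by rewrite /M' eqxx !inE eqxx yM.
  move=> /existsNP[S /negP]; rewrite -ltnNge => ltS.
  have eqS (U : {fset V}) : v \notin U ->
      \bigcup_(u <- U) M' u = \bigcup_(u <- U) M u.
    move=> vU; apply: eq_big_seq => u uU; rewrite /M'; case: eqP => // uv.
    by rewrite -uv uU in vU.
  have vS : v \in S.
    by apply: contraTT ltS => vS; rewrite eqS// -leqNgt; exact: hM.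
  have vS' : v \notin S `\ v by rewrite !inE eqxx.
  exists (S `\ v) => //.
  have : #|` S| = #|` S `\ v|.+1 by rewrite (cardfsD1 v) vS.
  move=> cS; rewrite cS ltnS in ltS; apply: leq_trans ltS.
  by rewrite [X in _ <= #|` X|](big_fsetD1 v vS) /= eqS// /M' eqxx fsetUC.
move=> y1 y2 y1M y2M; apply/eqP/negP => /negP y12.
have [S1 vS1 le1] := deficient _ y1M; have [S2 vS2 le2] := deficient _ y2M.
set P := _ `|` _ in le1; set Q := _ `|` _ in le2.
have : #|` S1 `|` S2|.+1 <= #|` P `|` Q|.
  have -> : #|` S1 `|` S2|.+1 = #|` v |` (S1 `|` S2)|.
    by rewrite cardfsU1 !inE negb_or vS1 vS2.
  apply: leq_trans (hM _) (fsubset_leq_card _).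
  apply/fsubsetP => y /bigfcupP[u /[!andbT] /[!inE] uS yM].
  have inb (S : {fset V}) : u \in S -> y \in \bigcup_(w <- S) M w.
    by move=> uS'; apply/bigfcupP; exists u; rewrite ?andbT.
  have [uv|] := eqVneq u v; last first.
    move=> uv; move: uS; rewrite (negPf uv) /=.
    by move=> /orP[]/inb->; rewrite ?orbT.
  by rewrite -uv yM !andbT; case: (eqVneq y y1) => [->|]; rewrite ?y12 ?orbT.
have : #|` S1 `&` S2| <= #|` P `&` Q|.
  apply: leq_trans (hM _) (fsubset_leq_card _).
  apply/fsubsetP => y /bigfcupP[u /[!andbT] /[!inE] /andP[uS1 uS2] yM].
  by apply/andP; split; apply/orP; left; apply/bigfcupP; exists u;
    rewrite ?andbT.
move=> leI leU; have := leq_add leU leI.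
rewrite addSn !cardfsUI ltnNge.
by rewrite leq_add.
Qed.

(** A minimal system consists of singletons: Hall's condition on one vertex excludes the empty set.
    Two vertices with the same singleton would violate the condition on that pair. *)
Theorem hall_matching N : hall_condition N ->
  exists2 f : V -> Y, injective f & forall v, f v \in N v.
Proof.
move=> /hall_minimal[M [hM sMN minM]].
have uM := hall_minimal_le1 hM minM.
have exM v : exists y, y \in M v.
  have := hM [fset v]; rewrite big_seq_fset1 cardfs1 cardfs_gt0.
  by move=> /fset0Pn.
have [f fM] := choice exM; exists f => [u v fuv|v]; last first.
  exact: fsubsetP (sMN v) _ (fM v).
have M1 w : M w = [fset f w].
  apply/fsetP => y; rewrite inE; apply/idP/eqP => [yM|-> //].
  exact: uM yM (fM w).
apply/eqP; apply: contraT => uv.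
have := hM [fset u; v].
have -> : \bigcup_(w <- [fset u; v]) M w = [fset f u].
  apply/fsetP => y; rewrite inE; apply/bigfcupP/eqP.
    by move=> [w /[!andbT] /[!inE] /orP[]/eqP->]; rewrite M1 inE => /eqP ->.
  by move=> ->; exists u; rewrite ?inE ?eqxx.
by rewrite cardfs1 cardfs2 uv.
Qed.

End Hall.

(** * Two injective matchings with disjoint images *)

Section HallDouble.
Local Open Scope fset_scope.
Local Open Scope nat_scope.

(** Each vertex is duplicated by a boolean. A finite set [S] of copies has the same neighbours as
    its projection [S'] and at most twice as many elements. *)
Corollary hall_double_matching (V Y : choiceType) (N : V -> {fset Y}) :
    (forall S : {fset V}, 2 * #|` S| <= #|` \bigcup_(v <- S) N v|) ->
  exists2 f : V * bool -> Y, injective f & forall k, f k \in N k.1.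
Proof.
move=> hN; have [|f fI fN] := @hall_matching _ _ (fun k : V * bool => N k.1).
  move=> S; pose S' := [fset k.1 | k in S].
  have -> : \bigcup_(k <- S) N k.1 = \bigcup_(v <- S') N v.
    apply/fsetP => y; apply/bigfcupP/bigfcupP => -[k /[!andbT] kS yN].
      by exists k.1 => //; rewrite andbT; apply/imfsetP; exists k.
    by move: kS => /imfsetP[k' /= k'S kE]; exists k'; rewrite ?k'S -?kE.
  apply: leq_trans (hN S').
  pose S2 (b : bool) := [fset (v, b) | v in S'].
  have cS2 b : #|` S2 b| = #|` S'| by rewrite card_imfset// => u v [].
  have sS : S `<=` S2 true `|` S2 false.
    apply/fsubsetP => -[v b] vbS.
    have vS' : v \in S' by apply/imfsetP; exists (v, b).
    rewrite inE; apply/orP; case: b {vbS}; [left|right]; apply/imfsetP;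
      by exists v.
  apply: leq_trans (fsubset_leq_card sS) _.
  by rewrite cardfsU !cS2 addnn mul2n leq_subr.
by exists f.
Qed.

End HallDouble.

(** * Growth of finite sets when the Folner condition fails *)

Section Growth.
Variables (R : realType) (G : groupType) (X : choiceType) (phi : G -> X -> X).
Hypothesis phi_bij : forall g : G, bijective (phi g).
Hypothesis phi_one : forall x : X, phi 1%g x = x.
Local Open Scope fset_scope.

Definition translates (T : seq G) (E : {fset X}) : {fset X} :=
  \bigcup_(t <- T) [fset phi t x | x in E].

Lemma translatesP T (E : {fset X}) y :
  reflect (exists2 t, t \in T & exists2 x, x \in E & y = phi t x)
          (y \in translates T E).
Proof.
apply: (iffP (bigfcupP _ _ _ _)).
  by move=> [t /[!andbT] tT /imfsetP[x /= xE ->]]; exists t => //; exists x.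
move=> [t tT [x xE ->]]; exists t; rewrite ?andbT//.
by apply/imfsetP; exists x.
Qed.

(** The points that are not regular form a finite union of defect sets and nontrivial fixed-point
    sets, which a paradoxical cover may use freely as its pieces [B] and [C]. *)
Definition regular (W : seq G) (x : X) : Prop :=
  (forall p q, p \in W -> q \in W -> phi p (phi q x) = phi (p * q)%g x) /\
  (forall r, r \in W -> r <> 1%g -> phi r x <> x).

Lemma regular_sub W W' x : {subset W <= W'} -> regular W' x -> regular W x.
Proof.
by move=> sW [mW fW]; split=> [p q /sW pW /sW|r /sW]; [exact: mW|exact: fW].
Qed.

(* Where [phi] is multiplicative enough, [phi r] fixes [phi t x] iff
   [phi (t^-1 * r * t)] fixes [x]. *)
Lemma regular_translate (K T : seq G) : exists W, forall x, regular W x ->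
  forall t, t \in T -> regular K (phi t x).
Proof.
have [S [KS TS]] : exists S : seq G, {subset K <= S} /\ {subset T <= S}.
  by exists (K ++ T); split=> g gS; rewrite mem_cat gS ?orbT.
pose S2 := [seq (p * q)%g | p <- S, q <- S]; pose SV := [seq (p^-1)%g | p <- S].
pose W := S ++ S2 ++ SV ++ [seq (p * q)%g | p <- SV, q <- S2].
exists W => x [mW fW] t tT.
have SW g : g \in S -> g \in W by move=> gS; rewrite mem_cat gS.
have S2W p q : p \in S -> q \in S -> (p * q)%g \in W.
  by move=> pS qS; rewrite 2!mem_cat (allpairs_f ( *%g)) ?orbT.
have VW g : g \in S -> g^-1%g \in W.
  by move=> gS; rewrite 3!mem_cat map_f ?orbT.
have VS2W g p q : g \in S -> p \in S -> q \in S -> (g^-1 * (p * q))%g \in W.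
  move=> gS pS qS; rewrite 3!mem_cat; apply/orP; right; apply/orP; right.
  apply/orP; right; apply: (allpairs_f (fun p q => p * q)%g).
    exact: map_f.
  exact: (allpairs_f (fun p q => p * q)%g).
have {tT} tS := TS _ tT.
split=> [p q /KS pS /KS qS|r /KS rS r1 rx].
  by rewrite !mW ?mulgA ?S2W ?SW.
have := congr1 (phi t^-1%g) rx.
rewrite !mW ?VW ?S2W ?SW// mulVg phi_one; apply: fW; first exact: VS2W.
move=> /(congr1 (fun z => t * z * t^-1)%g).
by rewrite mulVKg mulgK mulg1 mulgV => /r1.
Qed.

(** By injectivity of [phi g] both halves of the symmetric difference have the same size, the number
    of points that the image adds to [E]. The truncated subtraction is exact since [E] lies in the
    union. *)
Lemma card_symdiff_image (g : G) (E : {fset X}) :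
  (#|` fset_set ((phi g @` [set` E]) `+` [set` E])|
   = (#|` E `|` [fset phi g x | x in E]| - #|` E|) * 2)%N.
Proof.
have gI : injective (phi g) by exact: bij_inj.
set gE := [fset phi g x | x in E].
have cgE : #|` gE| = #|` E| by rewrite card_imfset.
have -> : (phi g @` [set` E]) `+` [set` E] =
    [set` ((gE `\` E) `|` (E `\` gE))%fset]%classic.
  have gEP y : (phi g @` [set` E])%classic y <-> y \in gE.
    split=> [[x xE <-]|/imfsetP[x /= xE ->]]; last by exists x.
    by apply/imfsetP; exists x.
  apply/seteqP; split=> y /=; rewrite !inE.
    case=> -[]; first by move=> /gEP -> /negP ->.
    by move=> -> yE; rewrite andbT; apply/orP; right; apply/negP => /gEP.
  case/orP => /andP[yE1 yE2]; [left|right]; split => //.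
  - exact/gEP.
  - exact/negP.
  - by move=> /gEP; exact/negP.
rewrite set_fsetK.
have -> : #|` (gE `\` E) `|` (E `\` gE)| = (#|` gE `\` E| + #|` E `\` gE|)%N.
  rewrite -cardfsUI [X in (_ + #|` X|)%N](_ : _ = fset0) ?cardfs0 ?addn0//.
  by apply/fsetP => y; rewrite !inE; case: (y \in E); rewrite ?andbF.
rewrite !cardfsD cgE cardfsU cgE fsetIC -addnBA; last first.
  by apply: leq_trans (fsubset_leq_card (fsubsetIr E gE)) _; rewrite cgE.
by rewrite addKn muln2 addnn.
Qed.

Variables (K : seq G) (eps : R).
Hypothesis eps_gt0 : 0 < eps.
(** On sets of regular points the defect and fixed-point densities vanish, so only near-invariance
    can fail there. *)
Hypothesis noF : forall E : {fset X}, E != fset0 ->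
    (forall x, x \in E -> regular K x) ->
  exists2 g, g \in K &
    eps <= card R ((phi g @` [set` E]) `+` [set` E]) / card R [set` E].

(** With [D] the set of translates of [E], some [g] in [K] enlarges [D] by at least [eps / 2] times
    its size. As [D] is at least as large as [E], each step gains [eps / 2] times the size of [E];
    this linear bound suffices for doubling. *)
Lemma growth n : exists T W, forall E : {fset X},
    (forall x, x \in E -> regular W x) ->
  (1 + n%:R * (eps / 2)) * #|` E|%:R <= (#|` translates T E|%:R : R).
Proof.
have e2 : 0 < eps / 2 by rewrite divr_gt0.
elim: n => [|n [T [W IH]]].
  exists [:: 1%g], [::] => E _; rewrite mul0r addr0 mul1r ler_nat.
  apply: fsubset_leq_card; apply/fsubsetP => x xE.
  by apply/translatesP; exists 1%g; rewrite ?mem_head//; exists x.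
have [W' W'P] := regular_translate K T.
(* [W] serves the induction hypothesis, [W'] makes the translates regular for [K], and [K ++ T] lets
   [phi g (phi t x)] be rewritten as [phi (g * t) x]. *)
exists (T ++ [seq (k * t)%g | k <- K, t <- T]), (W ++ W' ++ K ++ T) => E EW.
have [->|E0] := eqVneq E fset0; first by rewrite cardfs0 mulr0.
set D := translates T E.
have leD : (1 + n%:R * (eps / 2)) * #|` E|%:R <= (#|` D|%:R : R).
  by apply: IH => x /EW; apply: regular_sub => g gW; rewrite mem_cat gW.
have leED : (#|` E|%:R : R) <= #|` D|%:R.
  apply: le_trans leD; rewrite ler_peMl// lerDl.
  by rewrite mulr_ge0// ltW.
have D0 : D != fset0.
  rewrite -cardfs_gt0 -(ltr_nat R); apply: lt_le_trans leED.
  by rewrite ltr_nat cardfs_gt0.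
have Dreg x : x \in D -> regular K x.
  move=> /translatesP[t tT [z zE ->]]; apply: W'P => //.
  by apply: regular_sub (EW _ zE) => g gW; rewrite !mem_cat gW orbT.
have [g gK] := noF D0 Dreg.
rewrite /card set_fsetK card_symdiff_image ler_pdivlMr ?ltr0n ?cardfs_gt0//.
rewrite natrM natrB ?fsubset_leq_card ?fsubsetUl//.
set c := (#|` _ `|` _|%:R : R) => leg.
have -> : (1 + n.+1%:R * (eps / 2)) * #|` E|%:R
   = ((1 + n%:R * (eps / 2)) * #|` E|%:R + eps / 2 * (#|` E|%:R : R))%R.
  by rewrite -natr1; rewrite !mulrDl !mul1r addrA.
(* The symmetric difference counts every new point twice, whence the half of [eps]. *)
have lec : (#|` D|%:R + eps / 2 * #|` D|%:R <= c)%R.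
  rewrite -lerBrDl mulrAC ler_pdivrMr//.
apply: (@le_trans _ _ (#|` D|%:R + eps / 2 * #|` D|%:R)%R).
  by rewrite lerD// ler_pM2l.
apply: le_trans lec _; rewrite ler_nat; apply: fsubset_leq_card.
apply/fsubsetP => y /fsetUP[/translatesP[t tT [x xE ->]]|/imfsetP[z /= + ->]].
  by apply/translatesP; exists t; rewrite ?mem_cat ?tT//; exists x.
move=> /translatesP[t tT [x xE ->]].
have [mW _] := EW _ xE.
rewrite mW ?mem_cat ?gK ?tT ?orbT//.
apply/translatesP; exists (g * t)%g; last by exists x.
by rewrite mem_cat (allpairs_f (fun p q => (p * q)%g) gK tT) orbT.
Qed.

Lemma doubling : exists T W, forall E : {fset X},
    (forall x, x \in E -> regular W x) ->
  (2 * #|` E| <= #|` translates T E|)%N.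
Proof.
have e2 : 0 < eps / 2 by rewrite divr_gt0.
pose n := Num.bound (eps / 2)^-1.
have n_ge : 1 <= n%:R * (eps / 2).
  rewrite -ler_pdivrMr// mul1r ltW//.
  by apply: archi_boundP; rewrite invr_ge0 ltW.
have [T [W TW]] := growth n; exists T, W => E /TW leT.
rewrite -(ler_nat R) natrM; apply: le_trans leT.
by rewrite ler_wpM2r// -[2%R]/((1 + 1)%R : R) lerD2l.
Qed.

End Growth.

(** * From doubling to a paradoxical cover *)

Section Paradox.
Variables (G : groupType) (X : choiceType) (phi : G -> X -> X).

(** It is enough to cover the regular points: the others fall into the defect and fixed-point sets
    of [W]. Arbitrary finite index types are then enumerated by ordinals. *)
Lemma paradoxical_fin (I : finType) (A : I -> set X) (g h : I -> G)
    (W : seq G) :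
    (forall x, regular phi W x -> exists i, A i x) ->
    trivIset [set: I * bool]
      (fun k => phi (if k.2 then h k.1 else g k.1) @` A k.1) ->
  paradoxical phi.
Proof.
move=> covA tA; pose J := {: 'I_(size W) * 'I_(size W)}.
pose w := tnth (in_tuple W).
(* [W] may contain 1, whose fixed-point set is not an admissible piece. *)
pose WN := [seq r <- W | r != 1%g].
exists #|{: I}|, #|J|, (size WN), (fun i => A (enum_val i)),
  (fun j => defect phi (w (enum_val j).1) (w (enum_val j).2)),
  (fun k => Fix (phi (tnth (in_tuple WN) k))); split.
- apply/esym/seteqP; split=> // x _ /=.
  have inW p : p \in W -> exists i, w i = p.
    move=> pW; have iW : (index p W < size W)%N by rewrite index_mem.
    by exists (Ordinal iW); rewrite /w (tnth_nth p) /= nth_index.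
  have [/covA[i Ai]|] := pselect (regular phi W x).
    by left; left; exists (enum_rank i) => //; rewrite enum_rankK.
  move=> /not_andP[|] /existsNP[p].
    move=> /existsNP[q] /not_implyP[/inW[i <-]] /not_implyP[/inW[j <-]] dij.
    by left; right; exists (enum_rank (i, j)) => //; rewrite /= enum_rankK.
  move=> /not_implyP[pW] /not_implyP[/eqP p1] /contrapT fixx; right.
  have pWN : p \in WN by rewrite mem_filter p1.
  have iW : (index p WN < size WN)%N by rewrite index_mem.
  by exists (Ordinal iW) => //=; rewrite /Fix /= (tnth_nth p) /= nth_index.
- exists (g \o enum_val), (h \o enum_val) => -[i b] [j c] _ _ /=.
  move=> /(tA (enum_val i, b) (enum_val j, c) Logic.I Logic.I).
  by move=> [/enum_val_inj -> ->].
- by move=> j; exists (w (enum_val j).1), (w (enum_val j).2).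
- move=> k; exists (tnth (in_tuple WN) k); split=> //; apply/eqP.
  by have := mem_tnth k (in_tuple WN); rewrite mem_filter => /andP[].
Qed.

(** Hall's theorem gives an injective [f] on two copies of the regular points, each value being a
    translate by an element of [T]. Cutting the regular points according to the pair of translating
    elements makes both copies of [f] act on each piece by fixed group elements. *)
Lemma doubling_paradoxical (T W : seq G) :
  (forall E : {fset X}, (forall x, x \in E -> regular phi W x) ->
    (2 * #|` E| <= #|` translates phi T E|)%N) ->
  paradoxical phi.
Proof.
move=> dbl; pose V := {x : X | `[< regular phi W x >]}.
pose N (v : V) : {fset X} := [fset phi t (val v) | t in T]%fset.
have [S|f fI fN] := @hall_double_matching _ _ N.
  pose E := [fset val v | v in S]%fset.
  have -> : #|` S| = #|` E| by rewrite card_imfset//; exact: val_inj.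
  have Ereg x : x \in E -> regular phi W x.
    by move=> /imfsetP[v /= _ ->]; exact: asboolW (valP v).
  apply: (leq_trans (dbl _ Ereg)); apply: fsubset_leq_card.
  apply/fsubsetP => y /translatesP[t tT [_ /imfsetP[v /= vS ->] ->]].
  by apply/bigfcupP; exists v; rewrite ?andbT//; apply/imfsetP; exists t.
pose w := tnth (in_tuple T).
have sel k : exists i, f k = phi (w i) (val k.1).
  have /imfsetP[t /= tT fE] := fN k.
  have iT : (index t T < size T)%N by rewrite index_mem.
  by exists (Ordinal iT); rewrite /w (tnth_nth t) /= nth_index.
have [s sP] := choice sel.
pose A (i : 'I_(size T) * 'I_(size T)) : set X :=
  [set val v | v in [set v : V | (s (v, false), s (v, true)) = i]].
apply: (@paradoxical_fin _ A (w \o fst) (w \o snd) W).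
  move=> x xW; pose v : V := exist _ x (asboolT xW).
  by exists (s (v, false), s (v, true)), v.
(* Translated pieces consist of values of [f] at arguments that determine [k], so injectivity of [f]
   makes them disjoint. *)
have imA k : (phi (if k.2 then w k.1.2 else w k.1.1) @` A k.1) `<=`
    [set f (v, k.2) | v in [set v : V | (s (v, false), s (v, true)) = k.1]].
  by case: k => i b _ [_ [v /= <- <-] <-]; exists v => //; rewrite sP; case: b.
move=> k k' _ _ [y [/imA[v /= vk <-] /imA[v' /= vk']]].
move=> /fI[v'v k2]; rewrite [k]surjective_pairing [k']surjective_pairing.
by rewrite -vk -vk' v'v k2.
Qed.

End Paradox.

Lemma nonparadoxical_folner (R : realType) (G : groupType) (X : choiceType)
    (phi : G -> X -> X) :
    (forall g, bijective (phi g)) -> (forall x, phi 1%g x = x) ->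
  ~ paradoxical phi -> folner_condition R phi.
Proof.
move=> phi_bij phi_one npar K eps finK eps_gt0.
apply: contrapT => noF; apply: npar.
pose Ks : seq G := fset_set K.
have KsP g : g \in Ks <-> K g.
  by rewrite /Ks in_fset_set// inE.
have [|T [W]] := @doubling R G X phi phi_bij phi_one Ks eps eps_gt0.
  move=> E E0 Ereg; apply: contrapT => nog; apply: noF.
  (* Regular points avoid the defect and fixed-point sets in question, so conditions (b) and (c)
     hold for [E] with density 0. *)
  have card0 A : A `&` [set` E] = set0 ->
      card R (A `&` [set` E]) / card R [set` E] < eps.
    by move=> ->; rewrite /card fset_set0 cardfs0 mul0r.
  exists [set` E]; split.
  - split; first exact: finite_fset.
    by have /fset0Pn[x xE] := E0; exists x.
  - move=> g /KsP gK; rewrite ltNge; apply/negP => le; apply: nog.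
    by exists g.
  - move=> p q /KsP pK /KsP qK; apply: card0.
    apply/seteqP; split=> // x [/= dx xE].
    by have [/(_ p q pK qK)] := Ereg x xE.
  - move=> g g1 /KsP gK; apply: card0.
    apply/seteqP; split=> // x [/= dx xE].
    by have [_ /(_ g gK g1)] := Ereg x xE.
exact: doubling_paradoxical.
Qed.

(** * Finitely additive measures, and why they exclude paradoxes *)

Section FiniteAdditivity.
Variables (R : realType) (X : Type) (mu : set X -> R).
Hypothesis mu_prob : fin_additive_probability mu.

Lemma fap_set0 : mu set0 = 0.
Proof.
have := fap_setU mu_prob (setI0 (@set0 X)); rewrite setU0.
by move=> /eqP; rewrite -subr_eq subrr eq_sym => /eqP.
Qed.

Lemma fap_le A B : A `<=` B -> mu A <= mu B.
Proof.
move=> sAB; rewrite -(setDUK sAB) (fap_setU mu_prob) ?setDIK//.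
by rewrite lerDl (fap_ge0 mu_prob).
Qed.

Lemma fap_le1 A : mu A <= 1.
Proof. by rewrite -(fap_setT mu_prob); exact: fap_le. Qed.

Lemma fap_setU_le A B : mu (A `|` B) <= mu A + mu B.
Proof.
rewrite -(setDUK (@subsetUl _ A B)) (fap_setU mu_prob) ?setDIK//.
by rewrite lerD2l fap_le// => x [[]].
Qed.

Lemma fap_setC A : mu (~` A) = 1 - mu A.
Proof.
rewrite -(fap_setT mu_prob) -(setUv A) (fap_setU mu_prob) ?setICr//.
by rewrite addrC addKr.
Qed.

Lemma fap_bigcup_le (I : finType) (F : I -> set X) :
  mu (\bigcup_i F i) <= \sum_i mu (F i).
Proof.
have -> : \bigcup_i F i = \big[setU/set0]_(i <- enum I) F i.
  by rewrite -bigcup_seq; apply: eq_bigcupl; split=> i //= _; rewrite mem_enum.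
rewrite -big_enum /=; elim: (enum I) => [|i s IHs].
  by rewrite !big_nil fap_set0.
by rewrite !big_cons (le_trans (fap_setU_le _ _))// lerD2l.
Qed.

Lemma fap_sum_trivIset_le1 (I : finType) (F : I -> set X) :
  trivIset [set: I] F -> \sum_i mu (F i) <= 1.
Proof.
move=> tF; apply: le_trans (fap_le1 (\big[setU/set0]_(i <- enum I) F i)).
rewrite -big_enum /=; elim: (enum I) (enum_uniq I) => [|i s IHs] /=.
  by rewrite !big_nil fap_set0.
move=> /andP[iNs us]; rewrite !big_cons (fap_setU mu_prob) ?lerD2l ?IHs//.
rewrite -bigcup_seq setI_bigcupr -subset0 => x [j /= js FFx].
by move: iNs; rewrite (tF i j)//; [rewrite js | exists x].
Qed.

End FiniteAdditivity.

Lemma amenable_nonparadoxical (R : realType) (G : groupType) (X : choiceType)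
    (phi : G -> X -> X) (mu : set X -> R) :
  amenable_almost_action mu phi -> essentially_free mu phi -> ~ paradoxical phi.
Proof.
move=> [prob bij one inv mul] free [l [m [n [A [B [C par]]]]]].
have [cov [g [h disj]] eqB eqC] := par.
have B0 i : mu (B i) = 0.
  have [p [q ->]] := eqB i; have [D [D1 Dmul]] := mul p q.
  apply/eqP; rewrite eq_le (fap_ge0 prob) andbT.
  have : mu (~` D) = 0 by rewrite (fap_setC prob) D1 subrr.
  by move=> <-; apply: (fap_le prob) => x dx Dx; apply: dx; rewrite Dmul.
have C0 i : mu (C i) = 0 by have [r [r1 ->]] := eqC i; exact: free.
have := fap_sum_trivIset_le1 prob disj.
(* By invariance both translates of [A i] have mass [mu (A i)], so the disjoint family has total
   mass twice the sum of the [mu (A i)]. *)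
rewrite -(pair_bigA _
  (fun i (b : bool) => mu (phi (if b then h i else g i) @` A i))) /=.
under eq_bigr do rewrite big_bool /= !inv.
rewrite big_split /= => le1.
have : mu setT <= \sum_i mu (A i).
  rewrite cov; apply: le_trans (fap_setU_le prob _ _) _.
  apply: le_trans (lerD (fap_setU_le prob _ _) (lexx _)) _.
  apply: le_trans (lerD (lerD (fap_bigcup_le prob _) (fap_bigcup_le prob _))
    (fap_bigcup_le prob _)) _.
  rewrite (eq_bigr _ (fun i _ => B0 i)) (eq_bigr _ (fun i _ => C0 i)).
  by rewrite !big1_eq !addr0.
by rewrite (fap_setT prob); lra.
Qed.

(** * Limits of bounded functions along an ultrafilter *)

Section UltraLimit.
Variables (R : realType) (I : Type) (U : set_system I) (UU : UltraFilter U).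
Implicit Types f : I -> R.

(** Compactness of the unit interval gives a cluster point, and a cluster point of an ultrafilter is
    a limit. The bounds are asked only eventually because densities obey them only for suitable
    [F]. *)
Lemma ultra_bounded_cvg f : (\forall i \near U, 0 <= f i <= 1) ->
  exists l : R, f @ U --> l.
Proof.
move=> f01; have U01 : (f @ U) [set` `[0, 1]%R].
  by apply: filterS f01 => i /= f01; rewrite in_itv.
have [l [_ clus]] := @segment_compact R 0 1 (f @ U) _ U01.
exists l => N Nl; have [//|UNC] := in_ultra_setVsetC (f @^-1` N) UU.
by have [y [/=]] := clus (~` N) N UNC Nl.
Qed.

End UltraLimit.

(** * Real-valued cardinality of finite sets *)

Section Card.
Variables (R : realType) (X : choiceType).

Lemma rcard_ge0 (A : set X) : 0 <= card R A.
Proof. exact: ler0n. Qed.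

Lemma rcard_gt0 (A : set X) : finite_set A -> A !=set0 -> 0 < card R A.
Proof.
move=> finA [x Ax]; rewrite ltr0n cardfs_gt0; apply/fset0Pn; exists x.
by rewrite in_fset_set// inE.
Qed.

Lemma rcard_le (A B : set X) : finite_set B -> A `<=` B -> card R A <= card R B.
Proof.
move=> finB sAB; rewrite ler_nat; apply: fsubset_leq_card.
by rewrite -fset_set_sub//; exact: sub_finite_set finB.
Qed.

Lemma rcard_setU (A B : set X) :
  finite_set A -> finite_set B -> A `&` B = set0 ->
  card R (A `|` B) = card R A + card R B.
Proof.
move=> finA finB AB0; rewrite /card fset_setU// -natrD -cardfsUI.
by rewrite -fset_setI// AB0 fset_set0 cardfs0 addn0.
Qed.

Lemma rcard_image (Y : choiceType) (f : X -> Y) (A : set X) :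
  injective f -> finite_set A -> card R (f @` A) = card R A.
Proof. by move=> fI finA; rewrite /card fset_set_image// card_imfset. Qed.

End Card.

(** * The measure as an ultralimit of densities along Folner sets *)

Section Folner.
Variables (R : realType) (G : groupType) (X : choiceType) (phi : G -> X -> X).
Hypothesis phi_bij : forall g : G, bijective (phi g).
Hypothesis phi_one : forall x : X, phi 1%g x = x.
Hypothesis folner : folner_condition R phi.

(** The Folner condition says that these sets of sets are inhabited for finite [K] and positive
    [eps]. They shrink as [K] grows and [eps] decreases, hence form a filter base. *)
Definition folner_sets (K : set G) (eps : R) : set (set X) := [set F |
  [/\ finite_set F /\ F !=set0,
      forall g, K g -> card R ((phi g @` F) `+` F) / card R F < eps,
      forall p q, K p -> K q ->
        card R (defect phi p q `&` F) / card R F < eps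
    & forall g, g <> 1%g -> K g ->
        card R (Fix (phi g) `&` F) / card R F < eps] ].

Lemma folner_sets_sub (K K' : set G) (e e' : R) :
  K' `<=` K -> e <= e' -> folner_sets K e `<=` folner_sets K' e'.
Proof.
move=> sK le_e F [F0 inv mul free]; split=> //.
- by move=> g /sK Kg; exact: lt_le_trans (inv g Kg) le_e.
- by move=> p q /sK Kp /sK Kq; exact: lt_le_trans (mul p q Kp Kq) le_e.
- by move=> g g1 /sK Kg; exact: lt_le_trans (free g g1 Kg) le_e.
Qed.

Definition folner_filter : set_system (set X) :=
  filter_from [set Ke : set G * R | finite_set Ke.1 /\ 0 < Ke.2]
    (fun Ke => folner_sets Ke.1 Ke.2).

Lemma folner_filter_proper : ProperFilter folner_filter.
Proof.
apply: filter_from_proper; last first.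
  by move=> [K e] [/= finK e0]; have [F FP] := folner finK e0; exists F.
apply: filter_from_filter; first by exists (set0, 1) => /=; split.
move=> [K e] [K' e'] [/= finK e0] [/= finK' e'0].
exists (K `|` K', Num.min e e'); first by rewrite /= finite_setU lt_min e0.
rewrite subsetI; split; apply: folner_sets_sub => /=.
- exact: subsetUl.
- by rewrite ge_min lexx.
- exact: subsetUr.
- by rewrite ge_min lexx orbT.
Qed.

Definition density (A F : set X) : R := card R (A `&` F) / card R F.

Lemma density01 A F : finite_set F -> F !=set0 -> 0 <= density A F <= 1.
Proof.
move=> finF F0; rewrite divr_ge0 ?rcard_ge0//= ler_pdivrMr ?rcard_gt0// mul1r.
by apply: rcard_le => // x [].
Qed.

Lemma density_setU A B F : finite_set F -> A `&` B = set0 ->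
  density (A `|` B) F = density A F + density B F.
Proof.
move=> finF AB0; rewrite /density -mulrDl setIUl rcard_setU//.
- exact: finite_setIr.
- exact: finite_setIr.
- by rewrite setIACA setIid AB0 set0I.
Qed.

Lemma density_image_dist (f : X -> X) A F : injective f -> finite_set F ->
  `|density (f @` A) F - density A F| <= card R ((f @` F) `+` F) / card R F.
Proof.
move=> fI finF.
have fin_fF : finite_set (f @` F) by exact: finite_image.
have finY : finite_set ((f @` F) `+` F).
  by rewrite finite_setU; split; exact: finite_setD.
have le_card (B C D : set X) : finite_set C -> finite_set D -> B `<=` C `|` D ->
    card R B <= card R C + card R D.
  move=> finC finD sB; apply: (le_trans (rcard_le R _ sB)).
    by rewrite finite_setU.
  by rewrite /card fset_setU// -natrD ler_nat cardfsU leq_subr.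
have cAF : card R (f @` (A `&` F)) = card R (A `&` F).
  by apply: rcard_image => //; exact: finite_setIr.
rewrite /density -mulrBl normrM normfV (ger0_norm (rcard_ge0 R F)).
rewrite ler_wpM2r ?invr_ge0 ?rcard_ge0// ler_distl -cAF.
rewrite lerBlDr; apply/andP; split; apply: le_card => //.
- exact: finite_setIr.
- move=> _ [x [Ax Fx] <-]; have [Ffx|NF] := pselect (F (f x)).
    by left; split=> //; exists x.
  by right; left; split=> //; exists x.
- by apply: finite_image; exact: finite_setIr.
- move=> _ [[x Ax <-] Ffx]; have [Fx|NF] := pselect (F x).
    by left; exists x.
  by right; right; split=> // -[y Fy /fI yx]; rewrite yx in Fy.
Qed.

Lemma folner_amenable : exists mu : set X -> R,
  amenable_almost_action mu phi /\ essentially_free mu phi.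
Proof.
have [U [UU sFU]] := ultraFilterLemma folner_filter_proper.
have nearF K eps : finite_set K -> 0 < eps ->
    \forall F \near U, folner_sets K eps F.
  by move=> finK eps0; apply: sFU; exists (K, eps).
have fin_near : \forall F \near U, finite_set F /\ F !=set0.
  by apply: filterS (nearF set0 1 _ _) => // F [].
have cvg_density A : exists l : R, density A @ U --> l.
  apply: ultra_bounded_cvg.
  by apply: filterS fin_near => F [finF F0]; exact: density01.
have [mu muP] := choice cvg_density.
have UF : ProperFilter U := @ultra_proper _ _ UU.
(* This will apply to fixed-point sets of nontrivial elements and to defect sets. *)
have mu_eq0 A : (forall eps, 0 < eps -> \forall F \near U, density A F < eps) ->
    mu A = 0.
  move=> small; apply: le_anti; apply/andP; split.
    apply/ler_addgt0Pr => eps eps0; rewrite add0r; apply: (cvgr_to_le (muP A)).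
    by apply: filterS (small _ eps0) => F; exact: ltW.
  apply: (cvgr_to_ge (muP A)); apply: filterS fin_near => F [finF F0].
  by have /andP[] := density01 A finF F0.
have mu_prob : fin_additive_probability mu.
  split.
  - move=> A; apply: (cvgr_to_ge (muP A)).
    apply: filterS fin_near => F [finF F0].
    by have /andP[] := density01 A finF F0.
  - move=> A B AB0; apply: (norm_cvg_unique (muP _)).
    apply: cvg_trans (cvgD (muP A) (muP B)); apply: near_eq_cvg.
    apply: filterS fin_near => F [finF F0].
    by rewrite density_setU.
  - apply: (norm_cvg_unique (muP _)); apply: cvg_near_cst.
    apply: filterS fin_near => F [finF F0].
    by rewrite /density setTI divff// gt_eqF// rcard_gt0.
exists mu; split; last first.
  move=> g g1; apply: mu_eq0 => eps eps0.
  by apply: filterS (nearF [set g] eps _ eps0) => // F [_ _ _ /(_ g g1)]; exact.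
split=> //.
- move=> g L; apply/eqP; rewrite -subr_eq0 -normr_eq0 eq_le normr_ge0 andbT.
  apply/ler_addgt0Pr => eps eps0; rewrite add0r.
  (* The gap between the two measures is the limit of the gaps between densities, which
     near-invariance under [g] keeps below [eps]. *)
  apply: (cvgr_to_le (cvg_norm (cvgB (muP (phi g @` L)) (muP L)))).
  apply: filterS (nearF [set g] eps _ eps0) => //.
  move=> F [[finF F0] /(_ g erefl) inv _ _]; apply/ltW; apply: le_lt_trans inv.
  by apply: density_image_dist => //; exact: bij_inj.
(* Multiplicativity holds exactly off the defect set, whose density tends to 0. *)
- move=> g h; exists (~` defect phi g h); split; last by move=> x /contrapT.
  rewrite fap_setC// mu_eq0 ?subr0// => eps eps0.
  have fin2 : finite_set [set g; h] by [].
  apply: filterS (nearF [set g; h] eps fin2 eps0) => F [_ _ mul _].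
  by apply: mul; [left|right].
Qed.
End Folner.

Theorem theorem4 (R : realType) (G : groupType) (X : choiceType)
    (phi : G -> X -> X)
    (phi_bij : forall g : G, bijective (phi g))
    (phi_one : forall x : X, phi 1%g x = x) :
  [<-> exists mu : set X -> R,
         amenable_almost_action mu phi /\ essentially_free mu phi;
       ~ paradoxical phi;
       folner_condition R phi].
Proof.
tfae.
- by move=> [mu [act free]]; exact: amenable_nonparadoxical act free.
- exact: nonparadoxical_folner.
- exact: folner_amenable.
Qed.
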